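(* Let $\mathcal{A}$ be an additive category, and let $A^{\cdot}\simeq B^{\cdot}$ be homotopy equivalent complexes in the homotopy category $K^b(\mathcal{A})$ of bounded complexes in $\mathcal{A}$. Then $$\sum_{i=-\infty}^{\infty}(-1)^i\langle A^i\rangle=\sum_{i=-\infty}^{\infty}(-1)^i\langle B^i\rangle$$ in the split Grothendieck group $\operatorname{K}_{\oplus}(\mathcal{A})$ of $\mathcal{A}$, where $\langle X\rangle$ denotes the element of $\operatorname{K}_{\oplus}(\mathcal{A})$ corresponding to an object $X$ of $\mathcal{A}$.
   Context: An additive category is a category with a zero object and finite biproducts in which every $\operatorname{Hom}_{\mathcal{A}}(A_1,A_2)$ is an abelian group and composition distributes over addition. The split Grothendieck group $\operatorname{K}_{\oplus}(\mathcal{A})$ of an additive category $\mathcal{A}$ is the abelian group generated by isomorphism classes $\langle A\rangle$ of objects of $\mathcal{A}$ modulo the relations $\langle A_1\oplus A_2\rangle=\langle A_1\rangle+\langle A_2\rangle$ for all objects $A_1,A_2$ of $\mathcal{A}$. Complexes are cohomologically graded: $A^{\cdot}$ has differentials $d^i:A^i\to A^{i+1}$ with $d^{i+1}d^i=0$, and is bounded if $A^i=0$ for all but finitely many $i\in\mathbb{Z}$ (so the sums above are finite). The objects of $K^b(\mathcal{A})$ are bounded complexes and its morphisms are chain maps modulo chain homotopy; two complexes are homotopy equivalent if they are isomorphic in $K^b(\mathcal{A})$. *)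

(* Defs.v *)
From HB Require Import structures.
From mathcomp Require Import all_boot all_order all_algebra.
From mathcomp Require Import boolp classical_sets functions cardinality fsbigop.
From mathcomp Require Import freeg.

Set Implicit Arguments.
Unset Strict Implicit.
Unset Printing Implicit Defensive.
Import Order.TTheory GRing.Theory Num.Theory.
Local Open Scope ring_scope.
Local Open Scope quotient_scope.

Record category := Category {
  obj :> Type;
  hom : obj -> obj -> Type;
  idm : forall X, hom X X;
  mcomp : forall X Y Z, hom Y Z -> hom X Y -> hom X Z;
  mcomp1m : forall X Y (f : hom X Y), mcomp (idm Y) f = f;
  mcompm1 : forall X Y (f : hom X Y), mcomp f (idm X) = f;
  mcompA : forall X Y Z W (h : hom Z W) (g : hom Y Z) (f : hom X Y),
    mcomp h (mcomp g f) = mcomp (mcomp h g) f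
}.
Arguments idm {c} X.
Arguments mcomp {c X Y Z} g f.

Definition isomorphic (C : category) (X Y : C) : Prop :=
  exists (f : hom X Y) (g : hom Y X), mcomp g f = idm X /\ mcomp f g = idm Y.
Arguments isomorphic C X Y : clear implicits.

Definition is_zero_object (C : category) (Z : C) : Prop :=
  forall X : C, (exists! f : hom Z X, True) /\ (exists! f : hom X Z, True).

Record preadditive_category := PreadditiveCategory {
  pobj : Type;
  phom : pobj -> pobj -> zmodType;
  pidm : forall X, phom X X;
  pcomp : forall X Y Z, phom Y Z -> phom X Y -> phom X Z;
  pcomp1m : forall X Y (f : phom X Y), pcomp (pidm Y) f = f;
  pcompm1 : forall X Y (f : phom X Y), pcomp f (pidm X) = f;
  pcompA : forall X Y Z W (h : phom Z W) (g : phom Y Z) (f : phom X Y),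
    pcomp h (pcomp g f) = pcomp (pcomp h g) f;
  pcompDl : forall X Y Z (g1 g2 : phom Y Z) (f : phom X Y),
    pcomp (g1 + g2) f = pcomp g1 f + pcomp g2 f;
  pcompDr : forall X Y Z (g : phom Y Z) (f1 f2 : phom X Y),
    pcomp g (f1 + f2) = pcomp g f1 + pcomp g f2
}.
Arguments pidm {p} X.
Arguments pcomp {p X Y Z} g f.

Coercion underlying_category (A : preadditive_category) : category :=
  @Category (pobj A) (@phom A) (@pidm A) (@pcomp A)
    (@pcomp1m A) (@pcompm1 A) (@pcompA A).

Notation "g \co f" := (pcomp g f) (at level 40, left associativity).

Definition is_biproduct (A : preadditive_category) (X1 X2 B : A) : Prop :=
  exists (i1 : phom X1 B) (i2 : phom X2 B) (p1 : phom B X1) (p2 : phom B X2),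
  [/\ p1 \co i1 = pidm X1, p2 \co i2 = pidm X2, p1 \co i2 = 0, p2 \co i1 = 0
    & i1 \co p1 + i2 \co p2 = pidm B].

Record additive_category := AdditiveCategory {
  apreadd :> preadditive_category;
  has_zero_object : exists Z : apreadd, is_zero_object Z;
  has_biproducts : forall X1 X2 : apreadd, exists B : apreadd, is_biproduct X1 X2 B
}.

Section PreadditiveTheory.
Variable A : preadditive_category.
Implicit Types X Y Z : A.

Lemma pcomp0m X Y Z (f : phom X Y) : (0 : phom Y Z) \co f = 0.
Proof. by apply: (addrI (0 \co f)); rewrite -pcompDl !addr0. Qed.

Lemma pcompm0 X Y Z (g : phom Y Z) : g \co (0 : phom X Y) = 0.
Proof. by apply: (addrI (g \co 0)); rewrite -pcompDr !addr0. Qed.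

Lemma pcompNm X Y Z (g : phom Y Z) (f : phom X Y) : (- g) \co f = - (g \co f).
Proof. by apply: (addrI (g \co f)); rewrite -pcompDl !subrr pcomp0m. Qed.

Lemma pcompmN X Y Z (g : phom Y Z) (f : phom X Y) : g \co (- f) = - (g \co f).
Proof. by apply: (addrI (g \co f)); rewrite -pcompDr !subrr pcompm0. Qed.

Lemma pcompBl X Y Z (g1 g2 : phom Y Z) (f : phom X Y) :
  (g1 - g2) \co f = g1 \co f - g2 \co f.
Proof. by rewrite pcompDl pcompNm. Qed.

Lemma pcompBr X Y Z (g : phom Y Z) (f1 f2 : phom X Y) :
  g \co (f1 - f2) = g \co f1 - g \co f2.
Proof. by rewrite pcompDr pcompmN. Qed.

End PreadditiveTheory.

Section IsoClasses.
Variable C : category.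

Lemma isomorphic_refl (X : C) : isomorphic C X X.
Proof. by exists (idm X), (idm X); rewrite mcomp1m. Qed.

Lemma isomorphic_sym (X Y : C) : isomorphic C X Y -> isomorphic C Y X.
Proof. by move=> [f [g [gf fg]]]; exists g, f. Qed.

Lemma isomorphic_trans (X Y Z : C) :
  isomorphic C X Y -> isomorphic C Y Z -> isomorphic C X Z.
Proof.
move=> [f [f' [f'f ff']]] [g [g' [g'g gg']]].
exists (mcomp g f), (mcomp f' g'); split.
  by rewrite mcompA -(mcompA f') g'g mcompm1.
by rewrite mcompA -(mcompA g) ff' mcompm1.
Qed.

Definition isob (X Y : {classic C}) : bool := `[< isomorphic C X Y >].

Lemma isob_equiv : equiv_class_of isob.
Proof.
split=> [X|X Y|Y X Z].
- exact/asboolP/isomorphic_refl.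
- by apply/asboolP/asboolP; exact: isomorphic_sym.
- move=> /asboolP XY /asboolP YZ; apply/asboolP.
  exact: isomorphic_trans XY YZ.
Qed.

Canonical isob_equiv_rel := EquivRelPack isob_equiv.
Canonical isob_encModRel := defaultEncModRel isob.

Definition iso_class := {eq_quot isob}.
HB.instance Definition _ := Choice.on iso_class.
HB.instance Definition _ : EqQuotient {classic C} isob iso_class :=
  EqQuotient.on iso_class.

Definition iso_class_of (X : C) : iso_class := \pi_iso_class (X : {classic C}).

Lemma iso_class_ofP (X Y : C) :
  iso_class_of X = iso_class_of Y <-> isomorphic C X Y.
Proof.
split=> [/eqP|XY]; last by apply/eqP; rewrite /iso_class_of piE; exact/asboolP.
by rewrite /iso_class_of piE => /asboolP.
Qed.

End IsoClasses.

Section SplitGrothendieckGroup.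
Variable A : additive_category.

Definition free_iso : zmodType := {freeg (iso_class A) / int}.

Definition gen (X : A) : free_iso := << iso_class_of X >>.

(* Membership in the subgroup of [free_iso] generated by the elements
   [gen B - (gen X1 + gen X2)], for B any biproduct of X1 and X2. *)
Inductive biproduct_relation : free_iso -> Prop :=
| BrelGen X1 X2 B of is_biproduct X1 X2 B :
    biproduct_relation (gen B - (gen X1 + gen X2))
| Brel0 : biproduct_relation 0
| BrelB u v of biproduct_relation u & biproduct_relation v :
    biproduct_relation (u - v).

Definition biproduct_relations : {pred free_iso} :=
  fun u => `[< biproduct_relation u >].

Lemma biproduct_relations_zmod_closed : zmod_closed biproduct_relations.
Proof.
split=> [|u v /asboolP Ru /asboolP Rv]; apply/asboolP; first exact: Brel0.
exact: BrelB.
Qed.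

HB.instance Definition _ := GRing.isZmodClosed.Build free_iso
  biproduct_relations biproduct_relations_zmod_closed.

Definition split_K0 : zmodType := Quotient.quot biproduct_relations.

Definition K0_class (X : A) : split_K0 :=
  \pi_(Quotient.quot biproduct_relations) (gen X).

Lemma K0_class_iso (X Y : A) : isomorphic A X Y -> K0_class X = K0_class Y.
Proof. by move=> /iso_class_ofP; rewrite /K0_class /gen => ->. Qed.

Lemma K0_class_biproduct (X1 X2 B : A) : is_biproduct X1 X2 B ->
  K0_class B = K0_class X1 + K0_class X2.
Proof.
move=> bB; rewrite /K0_class.
transitivity (\pi_(Quotient.quot biproduct_relations) (gen X1 + gen X2)).
  2: exact: Quotient.pi_add.
by apply/eqP; rewrite -Quotient.idealrBE; apply/asboolP; exact: BrelGen.
Qed.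

Lemma is_biproduct_zero (Z : A) : is_zero_object Z -> is_biproduct Z Z Z.
Proof.
move=> /(_ Z)[[h [_ hU]] _].
have E (f g : phom Z Z) : f = g by rewrite -(hU f I) -(hU g I).
by exists 0, 0, 0, 0; split; exact: E.
Qed.

Lemma K0_class_zero (Z : A) : is_zero_object Z -> K0_class Z = 0.
Proof.
move=> /is_biproduct_zero/K0_class_biproduct ZZ.
by apply: (addrI (K0_class Z)); rewrite -ZZ addr0.
Qed.

End SplitGrothendieckGroup.

Record bounded_complex (A : additive_category) := BoundedComplex {
  cobj :> int -> A;
  diff : forall i : int, phom (cobj i) (cobj (i + 1));
  diff_diff : forall i : int, diff (i + 1) \co diff i = 0;
  cbounded : finite_set [set i : int | ~ is_zero_object (cobj i)]
}.
Arguments diff {A} b i.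

Section ChainMaps.
Variable A : additive_category.
Implicit Types X Y Z : bounded_complex A.

Record chain_map X Y := ChainMap {
  cmap :> forall i : int, phom (X i) (Y i);
  cmap_diff : forall i : int, cmap (i + 1) \co diff X i = diff Y i \co cmap i
}.

Lemma chain_id_subproof X (i : int) :
  pidm (X (i + 1)) \co diff X i = diff X i \co pidm (X i).
Proof. by rewrite pcomp1m pcompm1. Qed.

Definition chain_id X : chain_map X X := ChainMap (@chain_id_subproof X).

Lemma chain_comp_subproof X Y Z (g : chain_map Y Z) (f : chain_map X Y) i :
  (g (i + 1) \co f (i + 1)) \co diff X i = diff Z i \co (g i \co f i).
Proof. by rewrite -pcompA cmap_diff !pcompA cmap_diff. Qed.

Definition chain_comp X Y Z (g : chain_map Y Z) (f : chain_map X Y) :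
  chain_map X Z := ChainMap (chain_comp_subproof g f).

(* A homotopy has components X^j -> Y^(j-1); writing j = i + 1 avoids casts
   between objects in propositionally equal degrees. *)
Definition homotopic X Y (f g : chain_map X Y) : Prop :=
  exists h : forall i : int, phom (X (i + 1)) (Y i),
  forall i : int, f (i + 1) - g (i + 1) =
    diff Y i \co h i + h (i + 1) \co diff X (i + 1).

Lemma eq_homotopic X Y (f g : chain_map X Y) :
  (forall i : int, f i = g i) -> homotopic f g.
Proof.
move=> fg; exists (fun=> 0) => i.
by rewrite pcompm0 pcomp0m addr0 fg subrr.
Qed.

Lemma homotopic_sym X Y (f g : chain_map X Y) : homotopic f g -> homotopic g f.
Proof.
move=> [h fg]; exists (fun i => - h i) => i.
by rewrite pcompmN pcompNm -opprD -fg opprB.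
Qed.

Lemma homotopic_trans X Y (f g k : chain_map X Y) :
  homotopic f g -> homotopic g k -> homotopic f k.
Proof.
move=> [h1 fg] [h2 gk]; exists (fun i => h1 i + h2 i) => i.
by rewrite pcompDr pcompDl addrACA -fg -gk addrA subrK.
Qed.

Lemma homotopic_comp X Y Z (g g' : chain_map Y Z) (f f' : chain_map X Y) :
  homotopic g g' -> homotopic f f' ->
  homotopic (chain_comp g f) (chain_comp g' f').
Proof.
move=> [k gg'] [h ff']; exists (fun i => g i \co h i + k i \co f' (i + 1)) => i.
have -> : chain_comp g f (i + 1) - chain_comp g' f' (i + 1) =
    g (i + 1) \co (f (i + 1) - f' (i + 1)) +
    (g (i + 1) - g' (i + 1)) \co f' (i + 1).
  by rewrite pcompBr pcompBl addrA subrK.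
rewrite ff' gg' !pcompDr !pcompDl !pcompA cmap_diff addrACA.
by congr (_ + (_ + _)); rewrite -!pcompA cmap_diff.
Qed.

Definition homotopicb X Y (f g : {classic chain_map X Y}) : bool :=
  `[< homotopic (f : chain_map X Y) (g : chain_map X Y) >].

Lemma homotopicb_equiv X Y : equiv_class_of (@homotopicb X Y).
Proof.
split=> [f|f g|g f k].
- exact/asboolP/eq_homotopic.
- by apply/asboolP/asboolP; exact: homotopic_sym.
- move=> /asboolP fg /asboolP gk; apply/asboolP.
  exact: homotopic_trans fg gk.
Qed.

Canonical homotopicb_equiv_rel X Y := EquivRelPack (homotopicb_equiv X Y).
Canonical homotopicb_encModRel X Y := defaultEncModRel (@homotopicb X Y).

Definition homotopy_class X Y := {eq_quot @homotopicb X Y}.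
HB.instance Definition _ X Y := Choice.on (homotopy_class X Y).
HB.instance Definition _ X Y :
    EqQuotient {classic chain_map X Y} (@homotopicb X Y) (homotopy_class X Y) :=
  EqQuotient.on (homotopy_class X Y).

Definition homotopy_class_of X Y (f : chain_map X Y) : homotopy_class X Y :=
  \pi_(homotopy_class X Y) (f : {classic chain_map X Y}).

Definition homotopy_class_repr X Y (a : homotopy_class X Y) : chain_map X Y :=
  repr a.

Lemma homotopy_class_ofP X Y (f g : chain_map X Y) :
  homotopy_class_of f = homotopy_class_of g <-> homotopic f g.
Proof.
split=> [/eqP|fg]; last first.
  by apply/eqP; rewrite /homotopy_class_of piE; exact/asboolP.
by rewrite /homotopy_class_of piE => /asboolP.
Qed.

Lemma homotopy_class_reprK X Y (a : homotopy_class X Y) :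
  homotopy_class_of (homotopy_class_repr a) = a.
Proof. exact: reprK. Qed.

Definition homotopy_id X : homotopy_class X X := homotopy_class_of (chain_id X).

Definition homotopy_comp X Y Z (b : homotopy_class Y Z)
    (a : homotopy_class X Y) : homotopy_class X Z :=
  homotopy_class_of (chain_comp (homotopy_class_repr b) (homotopy_class_repr a)).

Lemma homotopy_compE X Y Z (g : chain_map Y Z) (f : chain_map X Y) :
  homotopy_comp (homotopy_class_of g) (homotopy_class_of f) =
  homotopy_class_of (chain_comp g f).
Proof.
by apply/homotopy_class_ofP/homotopic_comp;
  apply/homotopy_class_ofP; rewrite homotopy_class_reprK.
Qed.

Lemma homotopy_comp1m X Y (a : homotopy_class X Y) :
  homotopy_comp (homotopy_id Y) a = a.
Proof.
rewrite -[a]homotopy_class_reprK homotopy_compE.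
by apply/homotopy_class_ofP/eq_homotopic => i /=; rewrite pcomp1m.
Qed.

Lemma homotopy_compm1 X Y (a : homotopy_class X Y) :
  homotopy_comp a (homotopy_id X) = a.
Proof.
rewrite -[a]homotopy_class_reprK homotopy_compE.
by apply/homotopy_class_ofP/eq_homotopic => i /=; rewrite pcompm1.
Qed.

Lemma homotopy_compA X Y Z W (c : homotopy_class Z W) (b : homotopy_class Y Z)
    (a : homotopy_class X Y) :
  homotopy_comp c (homotopy_comp b a) = homotopy_comp (homotopy_comp c b) a.
Proof.
rewrite -[a]homotopy_class_reprK -[b]homotopy_class_reprK.
rewrite -[c]homotopy_class_reprK !homotopy_compE.
by apply/homotopy_class_ofP/eq_homotopic => i /=; rewrite pcompA.
Qed.

Definition Kb : category :=
  Category homotopy_comp1m homotopy_compm1 homotopy_compA.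

End ChainMaps.
Arguments Kb A : clear implicits.

(* [\sum_(i \in [set: int])] is 0 by convention on a family with infinite
   support; this does not occur for a bounded complex. *)
Lemma K0_class_finite_support (A : additive_category) (X : bounded_complex A) :
  finite_set [set i : int | K0_class (X i) *~ ((-1) ^ i) != 0].
Proof.
apply: sub_finite_set (cbounded X) => i /= nz /K0_class_zero X0.
by rewrite X0 mul0rz eqxx in nz.
Qed.

(* Main.v *)
Require Import Defs.
From mathcomp Require Import all_boot all_order all_algebra.
From mathcomp Require Import boolp classical_sets functions cardinality fsbigop.
Local Open Scope classical_set_scope.
Local Open Scope ring_scope.

Set Implicit Arguments.
Unset Strict Implicit.
Import GRing.Theory.

(** In an arbitrary additive category idempotents need not split, so the mapping
cone of a homotopy equivalence cannot in general be broken into trivial two-term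
complexes.  What survives is that a contractible complex has isomorphic even
and odd parts: if d s + s d = 1, then s' = s d s is again a contraction, its
square vanishes, and therefore (d + s')^2 = d s' + s' d = 1.  The map d + s'
exchanges the even and the odd part and is its own inverse.

This argument sees only the parity of degrees, so everything is folded first.
The direct sums X0 and X1 of the even and odd terms of a bounded complex X form
a two-periodic complex with the class K0 X0 - K0 X1 equal to the alternating
sum, and differentials, chain maps and homotopies fold as well, by the
universal property [is_direct_sum].

For folded homotopy inverses f : X -> Y and g, with homotopies h for g f and
k for f g, the cone has parts X1 + Y0 and X0 + Y1 and differential
D = [[-d, 0], [f, e]].  The candidate contraction S = [[h, g], [0, -k]] only
gives D S + S D = [[1, 0], [m, 1]] with m = f h - k f [cone_homotopy_sum].
This matrix is invertible, which suffices: D commutes with D S + S D, hence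
with its inverse V, and S V is a genuine contraction
[homotopically_invertible_isomorphic].  So X1 + Y0 and X0 + Y1 are isomorphic,
which is the equality of the two alternating sums in the split Grothendieck
group. *)

(** * Contractible two-periodic complexes *)

Section TwoPeriodicContraction.
Variable A : preadditive_category.

Lemma contraction_idempotent (C0 C1 : A)
    (d0 s0 : phom C0 C1) (d1 s1 : phom C1 C0) :
    d0 \co d1 = 0 -> d1 \co s0 + s1 \co d0 = pidm C0 ->
  d1 \co s0 \co d1 = d1.
Proof.
move=> dd E; have -> : d1 \co s0 = pidm C0 - s1 \co d0 by rewrite -E addrK.
by rewrite pcompBl pcomp1m -pcompA dd pcompm0 subr0.
Qed.

(** With s' = s d s this is (d + s')^2 = 1 on one of the two parts.  Since
d s d = d, the morphisms d s and s d are complementary orthogonal idempotents;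
orthogonality kills s' s', while d s' and s' d reduce to d s and s d. *)
Lemma contraction_square (C0 C1 : A)
    (d0 s0 : phom C0 C1) (d1 s1 : phom C1 C0) :
    d1 \co d0 = 0 -> d0 \co d1 = 0 ->
    d1 \co s0 + s1 \co d0 = pidm C0 -> d0 \co s1 + s0 \co d1 = pidm C1 ->
  (d1 + s1 \co d0 \co s1) \co (d0 + s0 \co d1 \co s0) = pidm C0.
Proof.
move=> dd0 dd1 E0 E1.
have d1sd : d1 \co s0 \co d1 = d1 by exact: contraction_idempotent dd1 E0.
have d0sd : d0 \co s1 \co d0 = d0 by exact: contraction_idempotent dd0 E1.
have orth : d0 \co s1 \co (s0 \co d1) = 0.
  have -> : s0 \co d1 = pidm C1 - d0 \co s1 by rewrite -E1 addrC addKr.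
  by rewrite pcompBr pcompm1 pcompA d0sd subrr.
rewrite pcompDl !pcompDr dd0 add0r !pcompA d1sd.
rewrite -(pcompA s1 d0 s1) -(pcompA s1 _ d0) d0sd.
by rewrite -(pcompA s1 _ s0) -(pcompA s1 _ d1) -(pcompA (d0 \co s1) s0 d1)
  orth pcompm0 pcomp0m addr0 -E0.
Qed.

Lemma contractible_isomorphic (C0 C1 : A)
    (d0 s0 : phom C0 C1) (d1 s1 : phom C1 C0) :
    d1 \co d0 = 0 -> d0 \co d1 = 0 ->
    d1 \co s0 + s1 \co d0 = pidm C0 -> d0 \co s1 + s0 \co d1 = pidm C1 ->
  isomorphic A C0 C1.
Proof.
move=> dd0 dd1 E0 E1.
by exists (d0 + s0 \co d1 \co s0), (d1 + s1 \co d0 \co s1); split;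
  exact: contraction_square.
Qed.

(** The morphism u = d s + s d is a chain map for every s, since both u d and d u
equal d s d; hence the inverse of u is a chain map too. *)
Lemma homotopy_inverse_commutes (C0 C1 : A)
    (d0 s0 : phom C0 C1) (d1 s1 : phom C1 C0)
    (v0 : phom C0 C0) (v1 : phom C1 C1) :
    d1 \co d0 = 0 -> d0 \co d1 = 0 ->
    (d1 \co s0 + s1 \co d0) \co v0 = pidm C0 ->
    v1 \co (d0 \co s1 + s0 \co d1) = pidm C1 ->
  v1 \co d0 = d0 \co v0.
Proof.
move=> dd0 dd1 E0 E1.
rewrite -[in LHS](pcompm1 d0) -E0 -[in RHS](pcomp1m d0) -E1.
rewrite (pcompA d0) -!pcompA; congr (v1 \co _).
by rewrite !pcompA pcompDr !pcompDl !pcompA dd1 -(pcompA s0 d1) dd0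
  !pcomp0m pcompm0 pcomp0m add0r addr0.
Qed.

(** If the identity is null-homotopic up to an invertible u = d s + s d, then s
corrected by the inverse of u is a contraction. *)
Lemma homotopically_invertible_isomorphic (C0 C1 : A)
    (d0 s0 : phom C0 C1) (d1 s1 : phom C1 C0)
    (v0 : phom C0 C0) (v1 : phom C1 C1) :
    d1 \co d0 = 0 -> d0 \co d1 = 0 ->
    (d1 \co s0 + s1 \co d0) \co v0 = pidm C0 ->
    v0 \co (d1 \co s0 + s1 \co d0) = pidm C0 ->
    (d0 \co s1 + s0 \co d1) \co v1 = pidm C1 ->
    v1 \co (d0 \co s1 + s0 \co d1) = pidm C1 ->
  isomorphic A C0 C1.
Proof.
move=> dd0 dd1 uv0 vu0 uv1 vu1.
have vd0 : v1 \co d0 = d0 \co v0 by exact: homotopy_inverse_commutes uv0 vu1.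
have vd1 : v0 \co d1 = d1 \co v1 by exact: homotopy_inverse_commutes uv1 vu0.
apply: (@contractible_isomorphic C0 C1 d0 (s0 \co v0) d1 (s1 \co v1)) => //.
- by rewrite -(pcompA s1) vd0 !pcompA -pcompDl.
- by rewrite -(pcompA s0) vd1 !pcompA -pcompDl.
Qed.

End TwoPeriodicContraction.

(** * Two-by-two matrices and the mapping cone *)

(** The data hidden by the existential quantifiers of [is_biproduct], kept in one
object so that matrices can be written relative to it. *)
Record biproduct (A : preadditive_category) (X1 X2 : A) := Biproduct {
  bip_obj :> pobj A;
  in1 : phom X1 bip_obj;
  in2 : phom X2 bip_obj;
  pr1 : phom bip_obj X1;
  pr2 : phom bip_obj X2;
  pr1_in1 : pr1 \co in1 = pidm X1;
  pr2_in2 : pr2 \co in2 = pidm X2;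
  pr1_in2 : pr1 \co in2 = 0;
  pr2_in1 : pr2 \co in1 = 0;
  in_pr_sum : in1 \co pr1 + in2 \co pr2 = pidm bip_obj
}.

Lemma biproduct_is_biproduct (A : preadditive_category) (X1 X2 : A)
  (B : biproduct X1 X2) : is_biproduct X1 X2 (bip_obj B).
Proof.
exists (in1 B), (in2 B), (pr1 B), (pr2 B); split.
- exact: pr1_in1.
- exact: pr2_in2.
- exact: pr1_in2.
- exact: pr2_in1.
- exact: in_pr_sum.
Qed.

Lemma biproduct_exists (A : additive_category) (X1 X2 : A) :
  exists B : biproduct X1 X2, True.
Proof.
have [B [i1 [i2 [p1 [p2 [e1 e2 e3 e4 e5]]]]]] := has_biproducts X1 X2.
by exists (Biproduct e1 e2 e3 e4 e5).
Qed.

Section Matrices.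
Variable A : preadditive_category.

Lemma biproduct_hom_ext (X1 X2 Z : A) (B : biproduct X1 X2) (u v : phom B Z) :
  u \co in1 B = v \co in1 B -> u \co in2 B = v \co in2 B -> u = v.
Proof.
move=> uv1 uv2; rewrite -(pcompm1 u) -(pcompm1 v) -(in_pr_sum B).
by rewrite !pcompDr !pcompA uv1 uv2.
Qed.

Definition mx2 (X1 X2 Y1 Y2 : A) (B : biproduct X1 X2) (C : biproduct Y1 Y2)
    (a : phom X1 Y1) (b : phom X2 Y1) (c : phom X1 Y2) (d : phom X2 Y2) :
    phom B C :=
  (in1 C \co a + in2 C \co c) \co pr1 B + (in1 C \co b + in2 C \co d) \co pr2 B.

Lemma mx2_in1 (X1 X2 Y1 Y2 : A) (B : biproduct X1 X2) (C : biproduct Y1 Y2)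
    a b c d : mx2 B C a b c d \co in1 B = in1 C \co a + in2 C \co c.
Proof.
by rewrite pcompDl -!(pcompA _ _ (in1 B)) pr1_in1 pr2_in1 pcompm0 pcompm1 addr0.
Qed.

Lemma mx2_in2 (X1 X2 Y1 Y2 : A) (B : biproduct X1 X2) (C : biproduct Y1 Y2)
    a b c d : mx2 B C a b c d \co in2 B = in1 C \co b + in2 C \co d.
Proof.
by rewrite pcompDl -!(pcompA _ _ (in2 B)) pr1_in2 pr2_in2 pcompm0 pcompm1 add0r.
Qed.

Lemma mx2_comp (X1 X2 Y1 Y2 Z1 Z2 : A) (B : biproduct X1 X2)
    (C : biproduct Y1 Y2) (D : biproduct Z1 Z2) a b c d a' b' c' d' :
  mx2 C D a' b' c' d' \co mx2 B C a b c d =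
  mx2 B D (a' \co a + b' \co c) (a' \co b + b' \co d)
          (c' \co a + d' \co c) (c' \co b + d' \co d).
Proof.
apply: biproduct_hom_ext.
  rewrite -pcompA !mx2_in1 pcompDr !pcompA mx2_in1 mx2_in2.
  by rewrite !pcompDl !pcompDr !pcompA addrACA.
rewrite -pcompA !mx2_in2 pcompDr !pcompA mx2_in1 mx2_in2.
by rewrite !pcompDl !pcompDr !pcompA addrACA.
Qed.

Lemma mx2D (X1 X2 Y1 Y2 : A) (B : biproduct X1 X2) (C : biproduct Y1 Y2)
    a b c d a' b' c' d' :
  mx2 B C a b c d + mx2 B C a' b' c' d' =
  mx2 B C (a + a') (b + b') (c + c') (d + d').
Proof.
apply: biproduct_hom_ext.
  by rewrite pcompDl !mx2_in1 !pcompDr addrACA.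
by rewrite pcompDl !mx2_in2 !pcompDr addrACA.
Qed.

Lemma mx2_id (X1 X2 : A) (B : biproduct X1 X2) :
  mx2 B B (pidm X1) 0 0 (pidm X2) = pidm B.
Proof.
apply: biproduct_hom_ext.
  by rewrite mx2_in1 pcomp1m pcompm1 pcompm0 addr0.
by rewrite mx2_in2 pcomp1m pcompm1 pcompm0 add0r.
Qed.

Lemma mx2_0 (X1 X2 Y1 Y2 : A) (B : biproduct X1 X2) (C : biproduct Y1 Y2) :
  mx2 B C 0 0 0 0 = 0.
Proof. by rewrite /mx2 !pcompm0 !addr0 !pcomp0m addr0. Qed.

Lemma mx2_lower_unitriangular_inv (X1 X2 : A) (B : biproduct X1 X2) m m' :
    m + m' = 0 ->
  mx2 B B (pidm X1) 0 m (pidm X2) \co mx2 B B (pidm X1) 0 m' (pidm X2) = pidm B.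
Proof.
by move=> mm'; rewrite mx2_comp !pcomp0m !pcompm0 !pcomp1m pcompm1 mm' !addr0 add0r
  mx2_id.
Qed.

(** The cone is the sum of Y and the shift of X by one degree, hence the pairs
X1 + Y0 and X0 + Y1 and the sign on the differential of X.  Exchanging
the indices 0 and 1 gives the other half of each statement on cones. *)
Lemma cone_differential_square (X0 X1 Y0 Y1 : A)
    (d0 : phom X0 X1) (d1 : phom X1 X0) (e0 : phom Y0 Y1) (e1 : phom Y1 Y0)
    (f0 : phom X0 Y0) (f1 : phom X1 Y1)
    (C0 : biproduct X1 Y0) (C1 : biproduct X0 Y1) :
    d0 \co d1 = 0 -> e1 \co e0 = 0 -> f0 \co d1 = e1 \co f1 ->
  mx2 C1 C0 (- d0) 0 f0 e1 \co mx2 C0 C1 (- d1) 0 f1 e0 = 0.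
Proof.
move=> dd ee fd; rewrite mx2_comp !pcompm0 !pcomp0m pcompNm !pcompmN dd fd ee.
by rewrite !oppr0 !addr0 addNr mx2_0.
Qed.

(** The entry f h - k f cannot be expected to vanish: the homotopies h and k are
chosen independently, with no coherence between them.  It is harmless since a
lower unitriangular matrix is invertible. *)
Lemma cone_homotopy_sum (X0 X1 Y0 Y1 : A)
    (d0 : phom X0 X1) (d1 : phom X1 X0) (e0 : phom Y0 Y1) (e1 : phom Y1 Y0)
    (f0 : phom X0 Y0) (f1 : phom X1 Y1) (g0 : phom Y0 X0) (g1 : phom Y1 X1)
    (h0 : phom X0 X1) (h1 : phom X1 X0) (k0 : phom Y0 Y1) (k1 : phom Y1 Y0)
    (C0 : biproduct X1 Y0) (C1 : biproduct X0 Y1) :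
    g1 \co e0 = d0 \co g0 ->
    g1 \co f1 - pidm X1 = d0 \co h1 + h0 \co d1 ->
    f0 \co g0 - pidm Y0 = e1 \co k0 + k1 \co e0 ->
  mx2 C1 C0 (- d0) 0 f0 e1 \co mx2 C0 C1 h1 g0 0 (- k0) +
  mx2 C1 C0 h0 g1 0 (- k1) \co mx2 C0 C1 (- d1) 0 f1 e0 =
  mx2 C0 C0 (pidm X1) 0 (f0 \co h1 - k1 \co f1) (pidm Y0).
Proof.
move=> ge gf fg; rewrite !mx2_comp mx2D !pcompm0 !pcomp0m !pcompNm !pcompmN.
rewrite !addr0 !add0r ge addNr; congr mx2.
  by rewrite addrA -opprD -gf opprB addrNK.
by rewrite -addrA -opprD -fg opprB addrC addrNK.
Qed.

Lemma cone_isomorphic (X0 X1 Y0 Y1 : A)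
    (d0 : phom X0 X1) (d1 : phom X1 X0) (e0 : phom Y0 Y1) (e1 : phom Y1 Y0)
    (f0 : phom X0 Y0) (f1 : phom X1 Y1) (g0 : phom Y0 X0) (g1 : phom Y1 X1)
    (h0 : phom X0 X1) (h1 : phom X1 X0) (k0 : phom Y0 Y1) (k1 : phom Y1 Y0)
    (C0 : biproduct X1 Y0) (C1 : biproduct X0 Y1) :
    d1 \co d0 = 0 -> d0 \co d1 = 0 -> e1 \co e0 = 0 -> e0 \co e1 = 0 ->
    f1 \co d0 = e0 \co f0 -> f0 \co d1 = e1 \co f1 ->
    g1 \co e0 = d0 \co g0 -> g0 \co e1 = d1 \co g1 ->
    g0 \co f0 - pidm X0 = d1 \co h0 + h1 \co d0 ->
    g1 \co f1 - pidm X1 = d0 \co h1 + h0 \co d1 ->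
    f0 \co g0 - pidm Y0 = e1 \co k0 + k1 \co e0 ->
    f1 \co g1 - pidm Y1 = e0 \co k1 + k0 \co e1 ->
  isomorphic A (bip_obj C0) (bip_obj C1).
Proof.
move=> dd0 dd1 ee0 ee1 fd0 fd1 ge0 ge1 gf0 gf1 fg0 fg1.
pose m0 := f0 \co h1 - k1 \co f1; pose m1 := f1 \co h0 - k0 \co f0.
apply: (@homotopically_invertible_isomorphic A (bip_obj C0) (bip_obj C1)
  (mx2 C0 C1 (- d1) 0 f1 e0) (mx2 C0 C1 h1 g0 0 (- k0))
  (mx2 C1 C0 (- d0) 0 f0 e1) (mx2 C1 C0 h0 g1 0 (- k1))
  (mx2 C0 C0 (pidm X1) 0 (- m0) (pidm Y0))
  (mx2 C1 C1 (pidm X0) 0 (- m1) (pidm Y1))).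
- exact: cone_differential_square.
- exact: cone_differential_square.
- by rewrite cone_homotopy_sum // mx2_lower_unitriangular_inv // subrr.
- by rewrite cone_homotopy_sum // mx2_lower_unitriangular_inv // addNr.
- by rewrite cone_homotopy_sum // mx2_lower_unitriangular_inv // subrr.
- by rewrite cone_homotopy_sum // mx2_lower_unitriangular_inv // addNr.
Qed.

End Matrices.

(** * Finite direct sums of families *)

Lemma zero_object_hom_to (A : preadditive_category) (Z X : A) (u v : phom X Z) :
  is_zero_object Z -> u = v.
Proof. by move=> /(_ X)[_ [w [_ wU]]]; rewrite -(wU u I) -(wU v I). Qed.

Lemma zero_object_hom_from (A : preadditive_category) (Z X : A) (u v : phom Z X) :
  is_zero_object Z -> u = v.
Proof. by move=> /(_ X)[[w [_ wU]] _]; rewrite -(wU u I) -(wU v I). Qed.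

(** A coproduct of the X j for j in r, with injections indexed by the whole of J and
extended by 0 outside r.  For families that vanish almost everywhere, or whose
odd or even terms are dropped, the universal property can then be used without
any membership proof in the type of the index. *)
Record is_direct_sum (A : preadditive_category) (J : eqType) (r : seq J)
    (X : J -> A) (S : A) (inj : forall j, phom (X j) S) : Prop := IsDirectSum {
  inj_out : forall j, j \notin r -> inj j = 0;
  copair_exists : forall (Z : A) (phi : forall j, phom (X j) Z),
    (forall j, j \notin r -> phi j = 0) ->
    exists u : phom S Z, forall j, u \co inj j = phi j;
  direct_sum_hom_ext : forall (Z : A) (u v : phom S Z),
    (forall j, u \co inj j = v \co inj j) -> u = v
}.

(** The binary relations defining the split Grothendieck group give the class of a
direct sum built by iterated biproducts, so the class is computed alongside the
construction. *)
Lemma direct_sum_exists (A : additive_category) (J : eqType) (r : seq J)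
    (X : J -> A) : uniq r ->
  exists (S : A) (inj : forall j, phom (X j) S),
    is_direct_sum r inj /\ K0_class S = \sum_(j <- r) K0_class (X j).
Proof.
elim: r => [_|a r IHr /= /andP[ar /IHr[S [inj [injS KS]]]]].
  have [Z Z0] := has_zero_object A.
  exists Z, (fun=> 0); split; last by rewrite big_nil K0_class_zero.
  split=> // [W phi phi0|W u v _]; last exact: zero_object_hom_from.
  by exists 0 => j; rewrite pcomp0m phi0.
have [B _] := biproduct_exists (X a) S.
pose inj' := dfwith (fun j => in2 B \co inj j) (in1 B).
have inj'a : inj' a = in1 B by exact: dfwith_in.
have inj'E j : a != j -> inj' j = in2 B \co inj j by exact: dfwith_out.
exists (bip_obj B), inj'; split; last first.
  by rewrite big_cons -KS; exact/K0_class_biproduct/biproduct_is_biproduct.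
split=> [j|Z phi phi0|Z u v uv].
- rewrite inE negb_or eq_sym => /andP[aj jr].
  by rewrite inj'E // (inj_out injS) // pcompm0.
- have [|u uE] := copair_exists injS (phi := dfwith phi (0 : phom (X a) Z)).
    move=> j jr; have [<-|aj] := eqVneq a j; first exact: dfwith_in.
    by rewrite dfwith_out // phi0 // inE negb_or eq_sym aj.
  exists (phi a \co pr1 B + u \co pr2 B) => j.
  have [<-|aj] := eqVneq a j.
    by rewrite inj'a pcompDl -!pcompA pr1_in1 pr2_in1 pcompm0 pcompm1 addr0.
  rewrite inj'E // pcompDl !pcompA -(pcompA (phi a)) -(pcompA u) pr1_in2 pr2_in2.
  by rewrite pcompm0 pcomp0m add0r pcompm1 uE dfwith_out.
- apply: biproduct_hom_ext; first by rewrite -inj'a.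
  apply: (direct_sum_hom_ext injS) => j.
  have [<-|aj] := eqVneq a j; first by rewrite (inj_out injS) // !pcompm0.
  by rewrite -!pcompA -inj'E.
Qed.

(** Take classes in the isomorphism between the two parts of the mapping cone. *)
Lemma periodic_homotopy_equivalence_K0 (A : additive_category) (X0 X1 Y0 Y1 : A)
    (d0 : phom X0 X1) (d1 : phom X1 X0) (e0 : phom Y0 Y1) (e1 : phom Y1 Y0)
    (f0 : phom X0 Y0) (f1 : phom X1 Y1) (g0 : phom Y0 X0) (g1 : phom Y1 X1)
    (h0 : phom X0 X1) (h1 : phom X1 X0) (k0 : phom Y0 Y1) (k1 : phom Y1 Y0) :
    d1 \co d0 = 0 -> d0 \co d1 = 0 -> e1 \co e0 = 0 -> e0 \co e1 = 0 ->
    f1 \co d0 = e0 \co f0 -> f0 \co d1 = e1 \co f1 ->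
    g1 \co e0 = d0 \co g0 -> g0 \co e1 = d1 \co g1 ->
    g0 \co f0 - pidm X0 = d1 \co h0 + h1 \co d0 ->
    g1 \co f1 - pidm X1 = d0 \co h1 + h0 \co d1 ->
    f0 \co g0 - pidm Y0 = e1 \co k0 + k1 \co e0 ->
    f1 \co g1 - pidm Y1 = e0 \co k1 + k0 \co e1 ->
  K0_class X0 - K0_class X1 = K0_class Y0 - K0_class Y1.
Proof.
move=> dd0 dd1 ee0 ee1 fd0 fd1 ge0 ge1 gf0 gf1 fg0 fg1.
have [C0 _] := biproduct_exists X1 Y0; have [C1 _] := biproduct_exists X0 Y1.
have /K0_class_iso : isomorphic A (bip_obj C0) (bip_obj C1).
  exact: cone_isomorphic gf0 gf1 fg0 fg1.
rewrite (K0_class_biproduct (biproduct_is_biproduct C0)).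
rewrite (K0_class_biproduct (biproduct_is_biproduct C1)) => E.
by apply/eqP; rewrite subr_eq addrAC eq_sym subr_eq -E addrC.
Qed.

(** * Folding a bounded complex by parity *)

Lemma odd_absz_succ (i : int) : odd (absz (i + 1)) = ~~ odd (absz i).
Proof.
case: i => n; first by rewrite -PoszD addn1.
have -> : Negz n + 1 = - n%:Z by rewrite NegzE -addn1 PoszD opprD addrNK.
by rewrite abszN /= negbK.
Qed.

Definition parity_part (r : seq int) (b : bool) : seq int :=
  [seq i <- r | odd (absz i) == b].

(** Homotopies are indexed as X (i + 1) -> Y i, whereas the universal property wants
a family indexed by the source degree; the cast is confined to this lemma. *)
Lemma shifted_family_exists (P : int -> Type) (phi : forall i, P (i + 1)) :
  exists psi : forall i, P i, forall i, psi (i + 1) = phi i.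
Proof.
exists (fun i => ecast k (P k) (subrK 1 i) (phi (i - 1))) => i.
have cast_phi k (ki : k = i) (e : k + 1 = i + 1) : ecast l (P l) e (phi k) = phi i.
  by case: i / ki e => e; rewrite eq_axiomK.
by apply: cast_phi; rewrite addrK.
Qed.

Section Folding.
Variable A : additive_category.
Implicit Types (X Y : int -> A) (r : seq int).

(** Testing on the terms of degree i + 1 lets the homotopy identities be used in
the form in which they are given. *)
Lemma folded_hom_ext X r (S Z : A) (inj : forall i, phom (X i) S) (u v : phom S Z) :
    is_direct_sum r inj ->
    (forall i, u \co inj (i + 1) = v \co inj (i + 1)) ->
  u = v.
Proof.
move=> injS uv; apply: (direct_sum_hom_ext injS) => i.
by have := uv (i - 1); rewrite subrK.
Qed.

(** The side condition of the universal property for a map into the part of parity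
c whose component i -> j respects the two parities: outside the part of parity
b, either j has the wrong parity, so its injection is 0, or X i is a zero
object. *)
Lemma folded_out X Y r b c (T : A) (inj : forall i, phom (Y i) T) i j
    (phi : phom (X i) (Y j)) :
    is_direct_sum (parity_part r c) inj ->
    (forall i, i \notin r -> is_zero_object (X i)) ->
    (odd (absz i) == b) = (odd (absz j) == c) ->
    i \notin parity_part r b ->
  inj j \co phi = 0.
Proof.
move=> injT X0 bc; rewrite mem_filter negb_and bc => /orP[jc|/X0 Xi0].
  by rewrite (inj_out injT) ?pcomp0m // mem_filter negb_and jc.
by rewrite (zero_object_hom_from phi 0 Xi0) pcompm0.
Qed.

Variables (r : seq int) (X Y : int -> A) (SX SY : bool -> A).
Variables (injX : forall b i, phom (X i) (SX b)).
Variables (injY : forall b i, phom (Y i) (SY b)).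
Hypothesis X0 : forall i, i \notin r -> is_zero_object (X i).
Hypothesis injXP : forall b, is_direct_sum (parity_part r b) (injX b).
Hypothesis injYP : forall b, is_direct_sum (parity_part r b) (injY b).

Lemma fold_degree0 (phi : forall i, phom (X i) (Y i)) b :
  exists u : phom (SX b) (SY b), forall i, u \co injX b i = injY b i \co phi i.
Proof.
by apply: (copair_exists (injXP b)) => i ir; apply: (folded_out _ (injYP b) X0 _ ir).
Qed.

Lemma fold_degree1 (phi : forall i, phom (X i) (Y (i + 1))) b :
  exists u : phom (SX b) (SY (~~ b)),
    forall i, u \co injX b i = injY (~~ b) (i + 1) \co phi i.
Proof.
apply: (copair_exists (injXP b)) => i ir.
apply: (folded_out _ (injYP (~~ b)) X0 _ ir).
by rewrite odd_absz_succ (inj_eq negb_inj).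
Qed.

Lemma fold_degreeN1 (phi : forall i, phom (X (i + 1)) (Y i)) b :
  exists u : phom (SX b) (SY (~~ b)),
    forall i, u \co injX b (i + 1) = injY (~~ b) i \co phi i.
Proof.
have [psi psiE] := shifted_family_exists
  (P := fun i => phom (X i) (SY (~~ b))) (fun i => injY (~~ b) i \co phi i).
have [|u uE] := copair_exists (injXP b) (phi := psi).
  suff psi0 j : j + 1 \notin parity_part r b -> psi (j + 1) = 0.
    by move=> i; have := psi0 (i - 1); rewrite subrK.
  rewrite psiE => jr; apply: (folded_out _ (injYP (~~ b)) X0 _ jr).
  by rewrite odd_absz_succ -(inj_eq negb_inj) negbK.
by exists u => i; rewrite uE psiE.
Qed.

End Folding.

Lemma euler_characteristic_parity (A : additive_category) (r : seq int)
    (X : int -> A) :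
    uniq r -> (forall i, i \notin r -> is_zero_object (X i)) ->
  \sum_(i \in [set: int]) K0_class (X i) *~ ((-1) ^ i) =
  \sum_(i <- parity_part r false) K0_class (X i) -
  \sum_(i <- parity_part r true) K0_class (X i).
Proof.
move=> ur X0; rewrite (fsbigE r _ ur) //; last first.
  by move=> i _ /X0/K0_class_zero ->; rewrite mul0rz.
rewrite !big_filter -sumrN addrC (bigID (fun i => odd (absz i) == true)) /=.
congr (_ + _); apply: eq_big => i; rewrite ?in_setT ?andTb //.
- by move=> /eqP io; rewrite expN1r -signr_odd io expr1 mulrN1z.
- by case: odd.
- by rewrite expN1r -signr_odd; case: odd; rewrite // expr0 mulr1z.
Qed.

Lemma bounded_complex_support (A : additive_category) (X : bounded_complex A) :
  exists r : seq int, forall i, i \notin r -> is_zero_object (X i).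
Proof.
have /finite_seqP[r rE] := cbounded X; exists r => i ir.
apply: contrapT => Xi; have : [set` r] i by rewrite -rE.
by rewrite /= (negPf ir).
Qed.

Lemma parity_sums_exist (A : additive_category) (r : seq int) (X : int -> A) :
    uniq r ->
  exists (S : bool -> A) (inj : forall b i, phom (X i) (S b)),
    (forall b, is_direct_sum (parity_part r b) (inj b)) /\
    (forall b, K0_class (S b) = \sum_(i <- parity_part r b) K0_class (X i)).
Proof.
move=> ur; have urb b : uniq (parity_part r b) by exact: filter_uniq.
have [S0 [inj0 [inj0S K0]]] := direct_sum_exists X (urb false).
have [S1 [inj1 [inj1S K1]]] := direct_sum_exists X (urb true).
exists (fun b => if b then S1 else S0).
exists (fun b => if b return forall i, phom (X i) (if b then S1 else S0)
                 then inj1 else inj0).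
by split; case.
Qed.

(** A single list r supports both complexes, so that both fold over the same
indices.  Every identity between folded maps is then checked on injections,
where it becomes the corresponding identity in each degree. *)
Lemma homotopic_inverse_euler_characteristic (A : additive_category)
    (X Y : bounded_complex A) (f : chain_map X Y) (g : chain_map Y X) :
    homotopic (chain_comp g f) (chain_id X) ->
    homotopic (chain_comp f g) (chain_id Y) ->
  \sum_(i \in [set: int]) K0_class (X i) *~ ((-1) ^ i) =
  \sum_(i \in [set: int]) K0_class (Y i) *~ ((-1) ^ i).
Proof.
move=> [h gf] [k fg].
have [rX X0'] := bounded_complex_support X.
have [rY Y0'] := bounded_complex_support Y.
pose r := undup (rX ++ rY); have ur : uniq r by exact: undup_uniq.
have X0 i : i \notin r -> is_zero_object (X i).
  by rewrite mem_undup mem_cat negb_or => /andP[/X0'].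
have Y0 i : i \notin r -> is_zero_object (Y i).
  by rewrite mem_undup mem_cat negb_or => /andP[_ /Y0'].
have [SX [iX [iXS KX]]] := parity_sums_exist X ur.
have [SY [iY [iYS KY]]] := parity_sums_exist Y ur.
rewrite (euler_characteristic_parity ur X0) (euler_characteristic_parity ur Y0).
rewrite -!KX -!KY.
have [d0 d0E] := fold_degree1 X0 iXS iXS (diff X) false.
have [d1 d1E] := fold_degree1 X0 iXS iXS (diff X) true.
have [e0 e0E] := fold_degree1 Y0 iYS iYS (diff Y) false.
have [e1 e1E] := fold_degree1 Y0 iYS iYS (diff Y) true.
have [f0 f0E] := fold_degree0 X0 iXS iYS f false.
have [f1 f1E] := fold_degree0 X0 iXS iYS f true.
have [g0 g0E] := fold_degree0 Y0 iYS iXS g false.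
have [g1 g1E] := fold_degree0 Y0 iYS iXS g true.
have [h0 h0E] := fold_degreeN1 X0 iXS iXS h false.
have [h1 h1E] := fold_degreeN1 X0 iXS iXS h true.
have [k0 k0E] := fold_degreeN1 Y0 iYS iYS k false.
have [k1 k1E] := fold_degreeN1 Y0 iYS iYS k true.
rewrite /= in d0 d0E d1 d1E e0 e0E e1 e1E h0 h0E h1 h1E k0 k0E k1 k1E.
apply: (@periodic_homotopy_equivalence_K0 A _ _ _ _ d0 d1 e0 e1 f0 f1 g0 g1 h0 h1 k0 k1).
- apply: (direct_sum_hom_ext (iXS false)) => i.
  by rewrite -pcompA d0E pcompA d1E -pcompA diff_diff pcompm0 pcomp0m.
- apply: (direct_sum_hom_ext (iXS true)) => i.
  by rewrite -pcompA d1E pcompA d0E -pcompA diff_diff pcompm0 pcomp0m.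
- apply: (direct_sum_hom_ext (iYS false)) => i.
  by rewrite -pcompA e0E pcompA e1E -pcompA diff_diff pcompm0 pcomp0m.
- apply: (direct_sum_hom_ext (iYS true)) => i.
  by rewrite -pcompA e1E pcompA e0E -pcompA diff_diff pcompm0 pcomp0m.
- apply: (direct_sum_hom_ext (iXS false)) => i.
  by rewrite -!pcompA d0E f0E !pcompA f1E e0E -!pcompA cmap_diff.
- apply: (direct_sum_hom_ext (iXS true)) => i.
  by rewrite -!pcompA d1E f1E !pcompA f0E e1E -!pcompA cmap_diff.
- apply: (direct_sum_hom_ext (iYS false)) => i.
  by rewrite -!pcompA e0E g0E !pcompA g1E d0E -!pcompA cmap_diff.
- apply: (direct_sum_hom_ext (iYS true)) => i.
  by rewrite -!pcompA e1E g1E !pcompA g0E d1E -!pcompA cmap_diff.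
- apply: (folded_hom_ext (iXS false)) => i.
  rewrite pcompBl pcompDl pcomp1m -!pcompA f0E h0E d0E !pcompA g0E d1E h1E.
  by rewrite -!pcompA -pcompDr -gf pcompBr pcompm1.
- apply: (folded_hom_ext (iXS true)) => i.
  rewrite pcompBl pcompDl pcomp1m -!pcompA f1E h1E d1E !pcompA g1E d0E h0E.
  by rewrite -!pcompA -pcompDr -gf pcompBr pcompm1.
- apply: (folded_hom_ext (iYS false)) => i.
  rewrite pcompBl pcompDl pcomp1m -!pcompA g0E k0E e0E !pcompA f0E e1E k1E.
  by rewrite -!pcompA -pcompDr -fg pcompBr pcompm1.
- apply: (folded_hom_ext (iYS true)) => i.
  rewrite pcompBl pcompDl pcomp1m -!pcompA g1E k1E e1E !pcompA f1E e0E k0E.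
  by rewrite -!pcompA -pcompDr -fg pcompBr pcompm1.
Qed.

Theorem theorem1p2 (A : additive_category) (X Y : Kb A)
    (XY : isomorphic (Kb A) X Y) :
  \sum_(i \in [set: int]) K0_class (X i) *~ ((-1) ^ i) =
  \sum_(i \in [set: int]) K0_class (Y i) *~ ((-1) ^ i) :> split_K0 A.
Proof.
have [a [b [ba ab]]] := XY.
by apply: (@homotopic_inverse_euler_characteristic A X Y
  (homotopy_class_repr a) (homotopy_class_repr b)); apply/homotopy_class_ofP.
Qed.
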